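(* Let $\pi$ be a permutation. Then $\pi$ is two-pop-stack sortable if and only if $\pi$ avoids all of the patterns $2341$, $3412$, $3421$, $4123$, $4231$, $4312$, $4\overline{1}352$, and $413\overline{5}2$.
   Context: $\mathcal{S}_n$ is the set of permutations of $[n]=\{1,\dots,n\}$, written as words $\pi_1\cdots\pi_n$. Pop stack operator: for $\pi\in\mathcal{S}_n$ (more generally for any word of distinct integers), let $\pi_1\cdots\pi_i$ be the longest decreasing prefix of $\pi$ (i.e. $\pi_1>\pi_2>\cdots>\pi_i$ and $i$ is maximal). Define $P$ recursively by $P(\pi)=\pi_i\pi_{i-1}\cdots\pi_1\,P(\pi_{i+1}\cdots\pi_n)$, with $P$ of the empty word being empty. Thus $P$ reverses each maximal contiguous decreasing run of $\pi$. A permutation $\pi\in\mathcal{S}_n$ is two-pop-stack sortable if $P(P(\pi))=12\cdots n$. Classical patterns: $\pi\in\mathcal{S}_n$ contains $\rho\in\mathcal{S}_k$ if there are $1\le i_1<\cdots<i_k\le n$ such that $\pi_{i_a}<\pi_{i_b}$ if and only if $\rho_a<\rho_b$; such a subsequence $\pi_{i_1}\cdots\pi_{i_k}$ is a copy of $\rho$. Otherwise $\pi$ avoids $\rho$. Barred patterns: a barred pattern is a permutation $\rho\in\mathcal{S}_k$ in which any entries may carry a bar. A permutation $\pi$ avoids the barred pattern $\rho$ if every copy in $\pi$ of the pattern formed by the non-barred entries of $\rho$ (order-isomorphic to those entries) extends to a copy of the full permutation formed by all entries of $\rho$, the given entries playing the roles of the non-barred entries. Otherwise $\pi$ contains $\rho$.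 For example, $\pi$ avoids $4\overline{1}352$ if and only if every occurrence of $3241$ (the pattern of $4352$) in $\pi$ is the ''$4352$'' part of an occurrence of $41352$. *)

(* Defs.v *)
From mathcomp Require Import all_boot all_fingroup.

Set Implicit Arguments.
Unset Strict Implicit.
Unset Printing Implicit Defensive.

(* The one-line word pi_1 ... pi_n of pi, with entries in {1, ..., n}, whereas
   the elements of 'I_n are numbered from 0. *)
Definition word (n : nat) (pi : 'S_n) : seq nat :=
  [seq (pi i).+1 | i <- enum 'I_n].

Fixpoint decr_prefix_len (s : seq nat) : nat :=
  match s with
  | [::] => 0
  | x :: s' =>
      if s' is y :: _ then
        if y < x then (decr_prefix_len s').+1 else 1
      else 1
  end.

Lemma decr_prefix_len_gt0 (s : seq nat) : s != [::] -> 0 < decr_prefix_len s.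
Proof. by case: s => [|x [|y s]] //= _; case: ifP. Qed.

Lemma decr_prefix_lenP (s : seq nat) (i : nat) :
  i <= size s -> sorted gtn (take i s) = (i <= decr_prefix_len s).
Proof.
elim: s i => [|x s IHs] [|i] //=; rewrite ltnS => le_is.
case: s IHs le_is => [|y s] IHs; first by case: i.
case: i => [|i] le_is; first by case: ifP.
have /= := IHs _ le_is => IH.
by case: ltnP => //= _; rewrite IH.
Qed.

(* m bounds the length of s and serves only for termination; the intended
   recursive equation is pop_stackE below, decr_prefix_len s being the length
   of the longest decreasing prefix by decr_prefix_lenP. *)
Fixpoint pop_stack_rec (m : nat) (s : seq nat) : seq nat :=
  if m is m'.+1 then
    let i := decr_prefix_len s in
    rev (take i s) ++ pop_stack_rec m' (drop i s)
  else [::].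

Definition pop_stack (s : seq nat) : seq nat := pop_stack_rec (size s) s.

Lemma pop_stack_rec_size (m : nat) (s : seq nat) :
  size s <= m -> pop_stack_rec m s = pop_stack s.
Proof.
have nilE k : pop_stack_rec k [::] = [::] by elim: k.
rewrite /pop_stack; have [k] := ubnP (size s).
elim: k m s => // k IHk [|m] [|x s]; rewrite ?nilE // ltnS => le_sk le_sm.
have lt_d : size (drop (decr_prefix_len (x :: s)) (x :: s)) < size (x :: s).
  by rewrite size_drop ltn_subrL decr_prefix_len_gt0.
have lt_dk := leq_trans lt_d le_sk; have le_ds := lt_d; rewrite /= ltnS in le_ds.
rewrite /=; congr (_ ++ _).
by rewrite (IHk m) ?(IHk (size s) (drop _ _)) // (leq_trans le_ds).
Qed.

Lemma pop_stackE (s : seq nat) :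
  pop_stack s =
    if s is [::] then [::]
    else rev (take (decr_prefix_len s) s) ++
         pop_stack (drop (decr_prefix_len s) s).
Proof.
case: s => // x s; rewrite -(@pop_stack_rec_size (size s) (drop _ _)) //.
by rewrite -ltnS -[(size s).+1]/(size (x :: s)) size_drop ltn_subrL
  decr_prefix_len_gt0.
Qed.

Definition two_pop_stack_sortable (n : nat) (pi : 'S_n) : Prop :=
  pop_stack (pop_stack (word pi)) = iota 1 n.

Definition order_isomorphic (u v : seq nat) : Prop :=
  size u = size v /\
  forall a b, a < size v -> b < size v ->
    (nth 0 u a < nth 0 u b) = (nth 0 v a < nth 0 v b).

(* A copy is given by its entries: those of pi are distinct, so they determine
   the positions. *)
Definition is_copy (n : nat) (pi : 'S_n) (rho t : seq nat) : Prop :=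
  subseq t (word pi) /\ order_isomorphic t rho.

(* Patterns are written as words. *)
Definition avoids (n : nat) (pi : 'S_n) (rho : seq nat) : Prop :=
  ~ exists t, is_copy pi rho t.

(* A barred pattern is given by the word rho of all its entries together with
   the list B of the entries that carry a bar. *)
Definition nonbarred (rho B : seq nat) : bitseq := [seq x \notin B | x <- rho].

Definition avoids_barred (n : nat) (pi : 'S_n) (rho B : seq nat) : Prop :=
  forall t, is_copy pi (mask (nonbarred rho B) rho) t ->
    exists2 u, is_copy pi rho u & mask (nonbarred rho B) u = t.

(* Main.v *)
(* The pop stack exchanges exactly the pairs that lie in one descending run, so
   [pop_stack u] is increasing iff u avoids 231 and 312. Applied to
   u = [pop_stack pi] and read back in pi, this says of every triple of pi:
   in a 231 the last two entries lie in one run, in a 312 the first two do, and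
   in a 321 the first two lie in one run iff the last two do. Entries lie in
   different runs iff there is an ascent between them, and the position of the
   two values of that ascent relative to the triple yields the patterns. *)

Require Import Defs.
From mathcomp Require Import all_boot all_fingroup.
From mathcomp Require Import zify.

Set Implicit Arguments.
Unset Strict Implicit.
Unset Printing Implicit Defensive.

(** * Descending runs and the order of entries after one pass *)

Lemma pop_stack_cat (s : seq nat) :
  pop_stack s = rev (take (decr_prefix_len s) s) ++
                pop_stack (drop (decr_prefix_len s) s).
Proof. by rewrite pop_stackE; case: s. Qed.

Lemma perm_pop_stack (s : seq nat) : perm_eq (pop_stack s) s.
Proof.
have [m] := ubnP (size s); elim: m s => // m IHm [|x s] //= lt_sm.
rewrite pop_stack_cat -[X in perm_eq _ X](cat_take_drop (decr_prefix_len (x :: s))).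
apply: perm_cat; first by rewrite perm_rev.
apply: IHm; have := @decr_prefix_len_gt0 (x :: s) isT.
by rewrite size_drop /= in lt_sm *; lia.
Qed.

(** For [i < j < size s] this says that positions [i] and [j] lie in one maximal descending run. It
    is vacuous for [j <= i], and for [j >= size s] the default 0 of [nth] enters the comparisons. *)
Definition desc (s : seq nat) (i j : nat) : bool :=
  all (fun k => nth 0 s k.+1 < nth 0 s k) (index_iota i j).

Lemma descP (s : seq nat) (i j : nat) :
  reflect (forall k, i <= k < j -> nth 0 s k.+1 < nth 0 s k) (desc s i j).
Proof.
apply: (iffP allP) => [H k Hk|H k]; first by apply: H; rewrite mem_index_iota.
by rewrite mem_index_iota; apply: H.
Qed.

Lemma desc_sub (s : seq nat) (i j a b : nat) :
  i <= a -> b <= j -> desc s i j -> desc s a b.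
Proof. by move=> leia lebj /descP D; apply/descP => k Hk; apply: D; lia. Qed.

Lemma ndescP (s : seq nat) (i j : nat) : uniq s -> j < size s ->
  reflect (exists2 k, i <= k < j & nth 0 s k < nth 0 s k.+1) (~~ desc s i j).
Proof.
move=> s_uniq ltjs; rewrite /desc -has_predC; apply: (iffP hasP) => -[k].
  rewrite mem_index_iota /= -leqNgt => /andP[leik ltkj] le_k.
  exists k; first by rewrite leik.
  have ltks := leq_ltn_trans ltkj ltjs.
  by rewrite ltn_neqAle le_k nth_uniq ?(ltnW ltks) // neq_ltn ltnSn.
by move=> Hk lt_k; exists k; rewrite ?mem_index_iota //= -leqNgt ltnW.
Qed.

Lemma desc_lt (s : seq nat) (i j : nat) :
  i < j -> desc s i j -> nth 0 s j < nth 0 s i.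
Proof.
move=> ltij /descP; elim: j ltij => // j IHj; rewrite ltnS leq_eqVlt.
case/predU1P=> [-> | ltij] H; first by apply: H; rewrite leqnn ltnSn.
apply: (@ltn_trans (nth 0 s j)); first by apply: H; lia.
by apply: IHj => // k Hk; apply: H; lia.
Qed.

Lemma desc_decr_prefix (s : seq nat) (j : nat) :
  j < size s -> desc s 0 j = (j < decr_prefix_len s).
Proof.
move=> ltjs; rewrite -decr_prefix_lenP //; apply/descP/(sortedP 0) => H k.
  rewrite size_take => Hk; rewrite !nth_take; try (case: ifP Hk; lia).
  by apply: H; case: ifP Hk; lia.
move=> Hk; have := H k; rewrite size_take !nth_take; try lia.
by apply; case: ifP; lia.
Qed.

(** Strong induction on the length, splitting off the first run, of length [d]. Two positions below
    [d] are exchanged by the reversal, two positions from [d] on are handled by induction, and a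
    pair across the boundary keeps its order. As entries are distinct, [index] recovers where each
    one lands. *)
Lemma index_pop_stack (s : seq nat) (i j : nat) :
  uniq s -> i < j -> j < size s ->
  (index (nth 0 s j) (pop_stack s) < index (nth 0 s i) (pop_stack s)) =
  desc s i j.
Proof.
have [m] := ubnP (size s); elim: m s i j => // m IHm t i j ltsm t_uniq ltij ltjt.
have m0 : 0 < decr_prefix_len t.
  by rewrite decr_prefix_len_gt0 //; case: t ltjt {ltsm t_uniq}.
have dP := @desc_decr_prefix t.
rewrite pop_stack_cat; set d := decr_prefix_len t in m0 dP *.
have le_dt : d <= size t.
  rewrite leqNgt; apply/negP => lt_td.
  have := decr_prefix_lenP (leqnn (size t)); rewrite -/d.
  have: decr_prefix_len t <= size t.
    by elim: (t) => //= y [|z u] //=; case: ifP.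
  by rewrite -/d; lia.
have tE := cat_take_drop d t.
have := t_uniq; rewrite -{1}tE cat_uniq => /and3P[u1 dis u2].
have st : size (take d t) = d by rewrite size_take; case: ifP => //; lia.
have memL k : k < d -> nth 0 t k \in rev (take d t).
  by move=> lt_k; rewrite mem_rev -(nth_take (n0 := d)) // mem_nth // st.
have memR k : d <= k -> k < size t -> nth 0 t k \notin rev (take d t).
  move=> le_k lt_k; rewrite mem_rev; apply: contra dis => H.
  apply/hasP; exists (nth 0 t k) => //.
  by rewrite -(subnKC le_k) -nth_drop mem_nth // size_drop ltn_sub2r //
    (leq_ltn_trans le_k).
have idxL k : k < d -> index (nth 0 t k) (rev (take d t)) = d - k.+1.
  move=> lt_k; rewrite -(nth_take (n0 := d)) //.
  have -> : nth 0 (take d t) k = nth 0 (rev (take d t)) (d - k.+1).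
    by rewrite nth_rev st; [congr nth|]; lia.
  by rewrite index_uniq ?rev_uniq // size_rev st; lia.
rewrite !index_cat; have [lt_jd | le_dj] := ltnP j d.
  rewrite !memL ?idxL //; try lia.
  have /descP D : desc t 0 j by rewrite dP.
  have -> : desc t i j by apply/descP => k Hk; apply: D; lia.
  by lia.
rewrite (negbTE (memR _ _ _)) // size_rev st.
have [lt_id | le_di] := ltnP i d.
  rewrite memL // idxL //.
  have -> : desc t i j = false.
    (* A descent from [i] to [j] would make the first [d.+1] entries decreasing, against the
       maximality of the first run. *)
    apply/negP=> /descP D; have := dP d; rewrite ltnn => /(_ _)/negbT/negP[].
      lia.
    apply/descP => k /= Hk; case: (ltnP k i) => Hki; last by apply: D; lia.
    have /descP : desc t 0 i by rewrite dP //; lia.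
    by apply; lia.
  by lia.
rewrite (negbTE (memR _ _ _)) //; last lia.
rewrite ltn_add2l -{1}(subnKC le_dj) -{1}(subnKC le_di) -!nth_drop.
rewrite IHm ?size_drop //; try lia.
apply/descP/descP => D k Hk.
  by have := D (k - d); rewrite !nth_drop addnS subnKC; [apply; lia|lia].
by rewrite !nth_drop addnS; apply: D; lia.
Qed.

Lemma index_pop_stackN (s : seq nat) (i j : nat) :
  uniq s -> i < j -> j < size s ->
  (index (nth 0 s i) (pop_stack s) < index (nth 0 s j) (pop_stack s)) =
  ~~ desc s i j.
Proof.
move=> s_uniq ltij ltjs; rewrite -index_pop_stack // -leqNgt ltn_neqAle.
case: eqP => // E; have memP k : k < size s -> nth 0 s k \in pop_stack s.
  by move=> ltks; rewrite (perm_mem (perm_pop_stack s)) mem_nth.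
have ltis := ltn_trans ltij ltjs.
have /eqP := index_inj 0 (memP _ ltis) (memP _ ltjs) E.
by rewrite nth_uniq // ltn_eqF.
Qed.

(** * Sortedness after one pass and after two passes *)

(** An inversion is repaired exactly when its two entries share a run, and no new inversion arises
    because exchanged entries were in descending order. *)
Lemma sorted_pop_stack (s : seq nat) : uniq s ->
  sorted ltn (pop_stack s) <->
  (forall i j, i < j -> j < size s -> nth 0 s j < nth 0 s i -> desc s i j).
Proof.
move=> s_uniq; have memP := perm_mem (perm_pop_stack s); split.
  move=> srt i j ltij ltjs; apply: contraTT; rewrite -index_pop_stackN //.
  rewrite -leqNgt => /(sorted_ltn_index ltn_trans srt).
  by rewrite !memP !mem_nth ?(ltn_trans ltij) // => /(_ isT isT)/ltnW.
move=> H; apply/(sortedP 0) => k ltk.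
have u : uniq (pop_stack s) by rewrite (perm_uniq (perm_pop_stack s)).
have : nth 0 (pop_stack s) k \in s by rewrite -memP mem_nth // ltnW.
have : nth 0 (pop_stack s) k.+1 \in s by rewrite -memP mem_nth.
case/(nthP 0) => j ltjs Ej /(nthP 0)[i ltis Ei].
have : index (nth 0 s i) (pop_stack s) < index (nth 0 s j) (pop_stack s).
  by rewrite Ei Ej !index_uniq // ltnW.
rewrite -Ei -Ej /=; case: (ltngtP i j) => [ltij|ltji|->]; last by rewrite ltnn.
  rewrite index_pop_stackN // => nd; rewrite ltnNge leq_eqVlt nth_uniq //.
  by rewrite gtn_eqF //; apply: contra nd; apply: H.
by rewrite index_pop_stack // => /(desc_lt ltji).
Qed.

Lemma sorted_pop_stack_avoids (s : seq nat) : uniq s ->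
  sorted ltn (pop_stack s) <->
  (forall i j k, i < j -> j < k -> k < size s ->
     ~ (nth 0 s k < nth 0 s i < nth 0 s j) /\
     ~ (nth 0 s j < nth 0 s k < nth 0 s i)).
Proof.
move=> s_uniq; rewrite sorted_pop_stack //; split=> H.
  move=> i j k ltij ltjk ltks; split=> /andP[lt1 lt2].
    have /descP D := H _ _ (ltn_trans ltij ltjk) ltks lt1.
    have: desc s i j by apply/descP => l Hl; apply: D; lia.
    by move/(desc_lt ltij); lia.
  have /descP D := H _ _ (ltn_trans ltij ltjk) ltks lt2.
  have: desc s j k by apply/descP => l Hl; apply: D; lia.
  by move/(desc_lt ltjk); lia.
(* An inversion across runs has an ascent [k], [k.+1] between its ends. If the top of the ascent
   exceeds the entry at [i], then [i], [k.+1], [j] form a 231; otherwise [i], [k], [k.+1] form a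
   312. *)
move=> i j ltij ltjs ltv; apply: contraT => /ndescP[] // k Hk asc.
have ltks : k.+1 < size s by case/andP: Hk => _ /leq_ltn_trans->.
have [ltc | gec] := ltnP (nth 0 s i) (nth 0 s k.+1).
  have kj : k.+1 <> j by move=> E; move: ltc; rewrite E; lia.
  by have [] := H i k.+1 j; lia.
have ki : k <> i by move=> E; move: gec; rewrite -E leqNgt asc.
have ne : nth 0 s k.+1 <> nth 0 s i.
  by apply/eqP; rewrite nth_uniq //; [|exact: ltn_trans ltij ltjs]; lia.
by have [] := H i k k.+1; lia.
Qed.

(** In a 231 or 312 of [pop_stack s], the two inverted pairs were already in that order in [s], so
    only the ascending pair can have been exchanged. If it was not, the triple has the same pattern
    in [s]; if it was, the triple is a 321 in [s] with exactly one adjacent pair of its entries in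
    one run. *)
Lemma sorted_pop_stack2 (s : seq nat) : uniq s ->
  sorted ltn (pop_stack (pop_stack s)) <->
  (forall p q r, p < q -> q < r -> r < size s ->
    [/\ nth 0 s r < nth 0 s p < nth 0 s q -> desc s q r,
        nth 0 s q < nth 0 s r < nth 0 s p -> desc s p q &
        nth 0 s r < nth 0 s q < nth 0 s p -> desc s p q = desc s q r]).
Proof.
move=> s_uniq; set t := pop_stack s.
have t_uniq : uniq t by rewrite (perm_uniq (perm_pop_stack s)).
have memP := perm_mem (perm_pop_stack s); rewrite -/t in memP.
rewrite sorted_pop_stack_avoids //; split=> H.
  (* The avoidance hypothesis on [t] is restated for positions of [s], with the order in [t]
     expressed through [index]. *)
  have {}H x y z : x < size s -> y < size s -> z < size s ->
      index (nth 0 s x) t < index (nth 0 s y) t ->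
      index (nth 0 s y) t < index (nth 0 s z) t ->
      ~ (nth 0 s z < nth 0 s x < nth 0 s y) /\
      ~ (nth 0 s y < nth 0 s z < nth 0 s x).
    move=> ltx lty ltz; move=> xy yz; have := H _ _ _ xy yz.
    by rewrite !nth_index ?memP ?mem_nth // index_mem memP mem_nth //; apply.
  move=> p q r ltpq ltqr ltrs.
  have ltqs := ltn_trans ltqr ltrs; have ltps := ltn_trans ltpq ltqs.
  have Hpq := index_pop_stack s_uniq ltpq ltqs.
  have Hqr := index_pop_stack s_uniq ltqr ltrs.
  have Npq := index_pop_stackN s_uniq ltpq ltqs.
  have Nqr := index_pop_stackN s_uniq ltqr ltrs.
  have ltpr := ltn_trans ltpq ltqr.
  have Hpr := index_pop_stack s_uniq ltpr ltrs.
  have Npr := index_pop_stackN s_uniq ltpr ltrs.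
  rewrite -/t in Hpq Hqr Npq Nqr Hpr Npr.
  split=> ltv.
  - apply: contraT => nd; have [] := H p q r; rewrite ?Npq ?Nqr //.
    by apply: contraL ltv => /(desc_lt ltpq); lia.
  - apply: contraT => nd; have [] := H p q r; rewrite ?Npq ?Nqr //.
    by apply: contraL ltv => /(desc_lt ltqr); lia.
  (* If exactly one of the two pairs shares a run, then [p] and [r] do not. The order in [t] is then
     [q], [p], [r], a 231, or [p], [r], [q], a 312. *)
  have Spr : desc s p r -> desc s p q && desc s q r.
    by move=> D; rewrite !(desc_sub _ _ D) // ltnW.
  apply/idP/idP => D; apply: contraT => nd.
    have [] := H q p r; rewrite ?Hpq ?Npr //.
    by apply: contra nd => /Spr/andP[].
  have [] := H p r q; rewrite ?Hqr ?Npr //.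
  by apply: contra nd => /Spr/andP[].
move=> i j k ltij ltjk ltkt.
have posn l : l < size t -> exists2 p, p < size s & nth 0 t l = nth 0 s p.
  move=> ltl; have: nth 0 t l \in s by rewrite -memP mem_nth.
  by case/(nthP 0) => p ltps E; exists p.
have ltjt := ltn_trans ltjk ltkt; have ltit := ltn_trans ltij ltjt.
have [x ltx Ex] := posn i ltit; have [y lty Ey] := posn j ltjt.
have [z ltz Ez] := posn k ltkt.
have xy : index (nth 0 s x) t < index (nth 0 s y) t.
  by rewrite -Ex -Ey !index_uniq.
have yz : index (nth 0 s y) t < index (nth 0 s z) t.
  by rewrite -Ey -Ez !index_uniq.
have xz := ltn_trans xy yz.
have before a b : a < size s -> b < size s ->
    index (nth 0 s a) t < index (nth 0 s b) t ->
    (a < b) && ~~ desc s a b || (b < a) && desc s b a.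
  move=> lta ltb; case: (ltngtP a b) => [ab|ba|->]; last by rewrite ltnn.
    by rewrite /t index_pop_stackN //= orbF.
  by rewrite /t index_pop_stack.
have dlt a b := @desc_lt s a b.
(* An inversion present in [t] was not created by an exchange, since an exchange turns a descent
   into an ascent. *)
have gt_before a b : a < size s -> b < size s ->
    index (nth 0 s a) t < index (nth 0 s b) t -> nth 0 s b < nth 0 s a ->
    a < b /\ ~~ desc s a b.
  move=> lta ltb /(before _ _ lta ltb)/orP[/andP[]//|/andP[ba dba]].
  by have := dlt _ _ ba dba; lia.
rewrite Ex Ey Ez; split=> /andP[lt1 lt2].
  have [ltxz nxz] := gt_before _ _ ltx ltz xz lt1.
  have [ltyz nyz] := gt_before _ _ lty ltz yz (ltn_trans lt1 lt2).
  case/orP: (before _ _ ltx lty xy) => /andP[oxy dxy].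
    by have [/(_ _)/idPn[]] := H _ _ _ oxy ltyz ltz; rewrite ?lt1.
  have [_ _] := H _ _ _ oxy ltxz ltz; rewrite lt1 lt2 dxy (negbTE nxz).
  by move/(_ isT).
have [ltxz nxz] := gt_before _ _ ltx ltz xz lt2.
have [ltxy nxy] := gt_before _ _ ltx lty xy (ltn_trans lt1 lt2).
case/orP: (before _ _ lty ltz yz) => /andP[oyz dyz].
  by have [_ /(_ _)/idPn[]] := H _ _ _ ltxy oyz ltz; rewrite ?lt1.
have [_ _] := H _ _ _ ltxz oyz lty; rewrite lt1 lt2 dyz (negbTE nxz).
by move/(_ isT).
Qed.

(** * From conditions on runs to forbidden patterns *)

Lemma ascent_desc (s : seq nat) (i j a b : nat) :
  i <= a -> a < b -> b <= j -> nth 0 s a < nth 0 s b -> desc s i j = false.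
Proof.
move=> leia ltab lebj asc; apply/negP => /(desc_sub leia lebj)/(desc_lt ltab).
by lia.
Qed.

(** Left to right, each pattern contains a triple whose condition forces a run across an ascent of
    the pattern. Right to left, a failing condition supplies an adjacent ascent [k], [k.+1] inside a
    segment, and comparing its two values with those of the triple always produces one of the
    patterns. *)
Lemma run_conditions_patterns (s : seq nat) : uniq s ->
  let f := nth 0 s in
  (forall p q r, p < q -> q < r -> r < size s ->
    [/\ f r < f p < f q -> desc s q r,
        f q < f r < f p -> desc s p q &
        f r < f q < f p -> desc s p q = desc s q r]) <->
  (forall i j k l, i < j -> j < k -> k < l -> l < size s ->
    [/\ ~ (f l < f i /\ f i < f j < f k),
        ~ (f k < f l /\ f l < f i < f j),
        ~ (f l < f k /\ f k < f i < f j),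
        ~ (f j < f k /\ f k < f l < f i) &
        ~ (f l < f j /\ f j < f k < f i)] /\
    [/\ ~ (f k < f l /\ f l < f j < f i),
        f l < f j /\ f j < f i < f k -> exists2 m, i < m < j & f m < f l &
        f j < f l /\ f l < f k < f i -> exists2 m, k < m < l & f i < f m]).
Proof.
move=> s_uniq f; have nD i j := @ndescP s i j s_uniq.
have asc i j a b := @ascent_desc s i j a b; rewrite -/f in nD asc.
have inj a b : a < b -> b < size s -> f a <> f b.
  move=> ltab ltbs; apply/eqP.
  by rewrite nth_uniq ?(ltn_eqF ltab) ?(ltn_trans ltab).
split=> H.
  have D1 p q r : p < q -> q < r -> r < size s -> f r < f p < f q -> desc s q r.
    by move=> ltpq ltqr ltrs; case: (H p q r ltpq ltqr ltrs).
  have D2 p q r : p < q -> q < r -> r < size s -> f q < f r < f p -> desc s p q.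
    by move=> ltpq ltqr ltrs; case: (H p q r ltpq ltqr ltrs).
  have H1 p q r a b : p < q -> q < r -> r < size s -> f r < f p < f q ->
      q <= a -> a < b -> b <= r -> f a < f b -> False.
    move=> ltpq ltqr ltrs ltv leqa ltab lebr /(asc q r a b leqa ltab lebr).
    by rewrite (D1 p).
  have H2 p q r a b : p < q -> q < r -> r < size s -> f q < f r < f p ->
      p <= a -> a < b -> b <= q -> f a < f b -> False.
    move=> ltpq ltqr ltrs ltv lepa ltab lebq /(asc p q a b lepa ltab lebq).
    by rewrite (D2 p q r).
  have H3 p q r : p < q -> q < r -> r < size s -> f r < f q < f p ->
      desc s p q = desc s q r.
    by move=> ltpq ltqr ltrs ltv; have [_ _ ->] := H p q r ltpq ltqr ltrs.
  move=> i j k l ltij ltjk ltkl ltls.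
  split; split.
  - by case=> lt1 lt2; apply: (H1 i j l j k); lia.
  - by case=> lt1 lt2; apply: (H2 i k l i j); lia.
  (* For 3421, the 231 at [i], [j], [l] puts [k] and [l] in one run; the 321 at [i], [k], [l] then
     forces a run from [i] to [k], across the ascent from [i] to [j]. *)
  - case=> lt1 lt2.
    have /(desc_sub (ltnW ltjk) (leqnn l)) : desc s j l.
      by apply: (D1 i); lia.
    by rewrite -(H3 i k l) ?(asc i k i j); lia.
  - by case=> lt1 lt2; apply: (H2 i k l j k); lia.
  - case=> lt1 lt2; have : desc s i j by apply: (D2 i j k); lia.
    by rewrite (H3 i j l) ?(asc j l j k); lia.
  - case=> lt1 lt2.
    have /(desc_sub (leqnn i) (ltnW ltjk)) : desc s i k.
      by apply: (D2 i k l); lia.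
    by rewrite (H3 i j l) ?(asc j l k l); lia.
  (* The ascent from [j] to [k] and the 321 at [i], [j], [l] yield an ascent [x], [x.+1] between [i]
     and [j]. Its bottom is the required small entry: otherwise either [i], [x.+1], [l] is a 231
     with an ascent in its last segment, or the 312 at [i], [x], [x.+1] contradicts the 321 at [i],
     [x], [l]. *)
  - case=> lt1 lt2; have : ~~ desc s i j by rewrite (H3 i j l) ?(asc j l j k); lia.
    case/nD=> [|x Hx ascx]; first lia.
    have := inj x l; have [lt_xl | le_lx] := ltnP (f x) (f l) => ne_xl.
      exists x => //; have [E|] := eqVneq x i; last lia.
      by move: lt_xl; rewrite E; lia.
    have := inj i x.+1; have [lt_iy | le_yi] := ltnP (f i) (f x.+1) => ne_iy.
      by case: (H1 i x.+1 l j k); lia.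
    have ne_ix : i <> x by move=> E; move: ascx le_yi; rewrite E; lia.
    have : desc s i x by apply: (D2 i x x.+1); lia.
    by rewrite (H3 i x l) ?(asc x l x x.+1); lia.
  (* The mirror argument: here the top [x.+1] of an ascent between [k] and [l] is the required large
     entry. *)
  - case=> lt1 lt2; have : ~~ desc s k l by rewrite -(H3 i k l) ?(asc i k j k); lia.
    case/nD=> [|x Hx ascx]; first lia.
    have := inj i x.+1; have [lt_iy | le_yi] := ltnP (f i) (f x.+1) => ne_iy.
      exists x.+1 => //; have [E|] := eqVneq x.+1 l; last lia.
      by move: lt_iy; rewrite E; lia.
    have := inj x l; have [lt_xl | le_lx] := ltnP (f x) (f l) => ne_xl.
      by case: (H2 i x l j k); lia.
    have ne_yl : x.+1 <> l by move=> E; move: ascx le_lx; rewrite E; lia.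
    have : desc s x.+1 l by apply: (D1 x); lia.
    by rewrite -(H3 i x.+1 l) ?(asc i x.+1 x x.+1); lia.
have N2341 i j k l : i < j -> j < k -> k < l -> l < size s ->
    f l < f i /\ f i < f j < f k -> False.
  by move=> lij ljk lkl lls; case: (H i j k l lij ljk lkl lls) => -[].
have N3412 i j k l : i < j -> j < k -> k < l -> l < size s ->
    f k < f l /\ f l < f i < f j -> False.
  by move=> lij ljk lkl lls; case: (H i j k l lij ljk lkl lls) => -[].
have N3421 i j k l : i < j -> j < k -> k < l -> l < size s ->
    f l < f k /\ f k < f i < f j -> False.
  by move=> lij ljk lkl lls; case: (H i j k l lij ljk lkl lls) => -[].
have N4123 i j k l : i < j -> j < k -> k < l -> l < size s ->
    f j < f k /\ f k < f l < f i -> False.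
  by move=> lij ljk lkl lls; case: (H i j k l lij ljk lkl lls) => -[].
have N4231 i j k l : i < j -> j < k -> k < l -> l < size s ->
    f l < f j /\ f j < f k < f i -> False.
  by move=> lij ljk lkl lls; case: (H i j k l lij ljk lkl lls) => -[].
have N4312 i j k l : i < j -> j < k -> k < l -> l < size s ->
    f k < f l /\ f l < f j < f i -> False.
  by move=> lij ljk lkl lls; case: (H i j k l lij ljk lkl lls) => _ [].
have B1 i j k l : i < j -> j < k -> k < l -> l < size s ->
    f l < f j /\ f j < f i < f k -> exists2 m, i < m < j & f m < f l.
  by move=> lij ljk lkl lls; case: (H i j k l lij ljk lkl lls) => _ [].
have B5 i j k l : i < j -> j < k -> k < l -> l < size s ->
    f j < f l /\ f l < f k < f i -> exists2 m, k < m < l & f i < f m.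
  by move=> lij ljk lkl lls; case: (H i j k l lij ljk lkl lls) => _ [].
move=> p q r ltpq ltqr ltrs; split=> ltv.
(* The ascent lies between [q] and [r]. A top above the entry at [q] gives 2341; otherwise a bottom
   below the entry at [r], between those at [r] and [p], or above that at [p] gives 3412, 3421 or
   4231. *)
- apply: contraT => /nD[] // k Hk asck.
  have lt_kr : k < r by lia.
  have := inj q k.+1; have := inj k r lt_kr ltrs; have := inj p k.
  have [lt_qy | le_yq] := ltnP (f q) (f k.+1) => ne_pk ne_kr ne_qy.
    have ne_yr : k.+1 <> r by move=> E; subst; lia.
    by case: (N2341 p q k.+1 r); lia.
  have ne_qk : q <> k by move=> E; subst; lia.
  have [lt_kr' | le_rk] := ltnP (f k) (f r).
    by case: (N3412 p q k r); lia.
  have [lt_kp | le_pk] := ltnP (f k) (f p).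
    by case: (N3421 p q k r); lia.
  have ne_yr : k.+1 <> r by move=> E; subst; lia.
  by case: (N4231 q k k.+1 r); lia.
- apply: contraT => /nD[|k Hk asck]; first lia.
  have ltqs := ltn_trans ltqr ltrs; have lt_kq : k < q by lia.
  have := inj p k.+1; have := inj k q lt_kq ltqs; have := inj k.+1 r.
  have [lt_kq' | le_qk] := ltnP (f k) (f q) => ne_yr ne_kq ne_py.
    have ne_pk : p <> k by move=> E; subst; lia.
    by case: (N4123 p k q r); lia.
  have ne_yq : k.+1 <> q by move=> E; subst; lia.
  have [lt_py | le_yp] := ltnP (f p) (f k.+1).
    by case: (N3412 p k.+1 q r); lia.
  have [lt_ry | le_yr] := ltnP (f r) (f k.+1).
    by case: (N4312 p k.+1 q r); lia.
  have ne_pk : p <> k by move=> E; subst; lia.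
  by case: (N4231 p k k.+1 q); lia.
apply/idP/idP => D; apply: contraT => /nD[|k Hk asck]; try lia.
  have lt_kr : k < r by lia.
  have := inj p k.+1; have := inj k r lt_kr ltrs.
  have [lt_kr' | le_rk] := ltnP (f k) (f r) => ne_kr ne_py.
    have ne_qk : q <> k by move=> E; subst; lia.
    by case: (N4312 p q k r); lia.
  have ne_yr : k.+1 <> r by move=> E; subst; lia.
  have [lt_py | le_yp] := ltnP (f p) (f k.+1).
    (* Here [p], [q], [k.+1], [r] form a 3241. The small entry supplied by the barred pattern lies
       between [p] and [q] and below the entry at [q], which breaks the run from [p] to [q]. *)
    have [|||||m Hm lt_mr] := B1 p q k.+1 r; try lia.
    by have := asc p q m q; rewrite D; lia.
  by case: (N4231 p k k.+1 r); lia.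
have ltqs := ltn_trans ltqr ltrs; have lt_kq : k < q by lia.
have := inj p k.+1; have := inj k q lt_kq ltqs; have := inj k r.
have [lt_py | le_yp] := ltnP (f p) (f k.+1) => ne_kr ne_kq ne_py.
  have ne_yq : k.+1 <> q by move=> E; subst; lia.
  by case: (N3421 p k.+1 q r); lia.
have ne_pk : p <> k by move=> E; subst; lia.
have [lt_kr | le_rk] := ltnP (f k) (f r).
  (* Here [p], [k], [q], [r] form a 4132, and the large entry supplied between [q] and [r] breaks
     the run from [q] to [r]. *)
  have [|||||m Hm lt_pm] := B5 p k q r; try lia.
  by have := asc q r q m; rewrite D; lia.
have [lt_kq' | le_qk] := ltnP (f k) (f q).
  by case: (N4231 p k q r); lia.
have ne_yq : k.+1 <> q by move=> E; subst; lia.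
by case: (N4231 p k k.+1 q); lia.
Qed.

(** * Pattern copies as increasing lists of positions *)

Lemma subseq_positionsP (s t : seq nat) :
  subseq t s <-> exists p, [/\ sorted ltn p, all (gtn (size s)) p &
                               t = [seq nth 0 s i | i <- p]].
Proof.
split=> [/subseqP[m sz_m ->]|[p [srt_p /allP lt_p ->]]].
  exists (mask m (iota 0 (size s))); split.
  - exact: (subseq_sorted ltn_trans (mask_subseq _ _) (iota_ltn_sorted _ _)).
  - by apply/allP => i /mem_mask; rewrite mem_iota.
  by rewrite map_mask -/(mkseq _ _) mkseq_nth.
(* A strictly increasing list of positions is determined by its set of elements, so it is a
   subsequence of the list of all positions. *)
have pE : p = filter (mem p) (iota 0 (size s)).
  apply: (irr_sorted_eq ltn_trans ltnn) => //.
    exact: sorted_filter ltn_trans _ _ (iota_ltn_sorted _ _).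
  by move=> i; rewrite mem_filter mem_iota /= andb_idr // => /lt_p.
have := map_subseq (nth 0 s) (filter_subseq (mem p) (iota 0 (size s))).
by rewrite -pE -/(mkseq _ _) mkseq_nth.
Qed.

(* [q] is the inverse of [v], as a list of 0-based indices. *)
Lemma order_isomorphic_sorted (u v q : seq nat) :
  size u = size v -> perm_eq q (iota 0 (size v)) ->
  sorted ltn [seq nth 0 v i | i <- q] ->
  order_isomorphic u v <-> sorted ltn [seq nth 0 u i | i <- q].
Proof.
move=> Euv pq srt_v; have memq i : (i \in q) = (i < size v).
  by rewrite (perm_mem pq) mem_iota.
split=> [[_ iso]|srt_u].
  rewrite sorted_map (@eq_in_sorted _ (mem q) _ (relpre (nth 0 v) ltn)) -?sorted_map //.
  by move=> a b aq bq; apply: iso; rewrite -memq.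
split=> // a b; rewrite -!memq => aq bq.
(* Both words compare positions by their rank in [q], so their comparisons agree. *)
have mono x : sorted ltn [seq nth 0 x i | i <- q] ->
    (nth 0 x a < nth 0 x b) = (index a q < index b q).
  move=> srt; have H c d : c \in q -> d \in q -> index c q < index d q ->
      nth 0 x c < nth 0 x d.
    move=> cq dq lt_cd.
    have := sorted_ltn_nth ltn_trans 0 srt (index c q) (index d q).
    rewrite !inE size_map !index_mem => /(_ cq dq lt_cd).
    by rewrite !(nth_map 0) ?index_mem // !nth_index.
  case: (ltngtP (index a q)) => [|/H|/index_inj->//]; first exact: H.
    by move=> /(_ bq aq); lia.
  by rewrite ltnn.
by rewrite !mono.
Qed.

(** * Words of permutations, and avoidance as inequalities between entries *)

Lemma word_uniq (n : nat) (pi : 'S_n) : uniq (word pi).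
Proof.
by rewrite map_inj_uniq ?enum_uniq // => i j [/val_inj/perm_inj].
Qed.

Lemma perm_word (n : nat) (pi : 'S_n) : perm_eq (word pi) (iota 1 n).
Proof.
apply: uniq_perm; rewrite ?word_uniq ?iota_uniq // => x.
rewrite mem_iota; apply/mapP/idP => [[i _ ->]|Hx]; first exact: (ltn_ord (pi i)).
have ltx : x.-1 < n by lia.
exists ((pi^-1)%g (Ordinal ltx)); rewrite ?mem_enum // permKV /=; lia.
Qed.

Lemma two_pop_stack_sortableE (n : nat) (pi : 'S_n) :
  two_pop_stack_sortable pi <-> sorted ltn (pop_stack (pop_stack (word pi))).
Proof.
rewrite /two_pop_stack_sortable; split=> [->|srt]; first exact: iota_ltn_sorted.
apply: (irr_sorted_eq ltn_trans ltnn) => //; first exact: iota_ltn_sorted.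
apply: perm_mem; apply: perm_trans (perm_word pi).
exact: perm_trans (perm_pop_stack _) (perm_pop_stack _).
Qed.

(** Listing the entries by rank through [q] replaces all pairwise comparisons by one sortedness
    condition, which for a concrete pattern computes to a chain of inequalities. *)
Lemma is_copyP (n : nat) (pi : 'S_n) (rho q t : seq nat) :
  perm_eq q (iota 0 (size rho)) -> sorted ltn [seq nth 0 rho i | i <- q] ->
  is_copy pi rho t <->
  exists p, [/\ size p = size rho, sorted ltn p, all (gtn (size (word pi))) p,
    t = [seq nth 0 (word pi) i | i <- p] & sorted ltn [seq nth 0 t i | i <- q]].
Proof.
move=> pq srt; rewrite /is_copy subseq_positionsP.
split=> [[[p [srt_p lt_p tE]] iso]|[p [sz_p srt_p lt_p tE srt_t]]].
  have sz_t : size t = size rho by case: iso.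
  exists p; split=> //; first by rewrite -sz_t tE size_map.
  by rewrite -(order_isomorphic_sorted sz_t pq srt).
have sz_t : size t = size rho by rewrite tE size_map.
by split; [exists p | rewrite (order_isomorphic_sorted sz_t pq srt)].
Qed.

Lemma is_copy4P (n : nat) (pi : 'S_n) (a b c d : nat) (q t : seq nat) :
  perm_eq q (iota 0 4) -> sorted ltn [seq nth 0 [:: a; b; c; d] i | i <- q] ->
  let f := nth 0 (word pi) in
  is_copy pi [:: a; b; c; d] t <->
  exists i j k l, [/\ [/\ i < j, j < k & k < l], l < size (word pi),
    t = [:: f i; f j; f k; f l] & sorted ltn [seq nth 0 t i | i <- q]].
Proof.
move=> pq srt f; rewrite (@is_copyP n pi [:: a; b; c; d] q t pq srt); split.
  case=> p [sz_p srt_p lt_p tE srt_t].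
  case: p sz_p srt_p lt_p tE => [|i [|j [|k [|l []]]]] //= _.
  case/and4P => lij ljk lkl _ /and5P[_ _ _ ll _] tE.
  by exists i, j, k, l.
case=> i [j [k [l [[lij ljk lkl] ll tE srt_t]]]]; exists [:: i; j; k; l].
by split=> //=; rewrite ?lij ?ljk ?lkl //; lia.
Qed.

Lemma is_copy5P (n : nat) (pi : 'S_n) (a b c d e : nat) (q t : seq nat) :
  perm_eq q (iota 0 5) -> sorted ltn [seq nth 0 [:: a; b; c; d; e] i | i <- q] ->
  let f := nth 0 (word pi) in
  is_copy pi [:: a; b; c; d; e] t <->
  exists i j k l m, [/\ [/\ i < j, j < k, k < l & l < m], m < size (word pi),
    t = [:: f i; f j; f k; f l; f m] & sorted ltn [seq nth 0 t i | i <- q]].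
Proof.
move=> pq srt f; rewrite (@is_copyP n pi [:: a; b; c; d; e] q t pq srt); split.
  case=> p [sz_p srt_p lt_p tE srt_t].
  case: p sz_p srt_p lt_p tE => [|i [|j [|k [|l [|m []]]]]] //= _.
  case/and5P => lij ljk lkl llm _ /and5P[_ _ _ _ /andP[lm _]] tE.
  by exists i, j, k, l, m.
case=> i [j [k [l [m [[lij ljk lkl llm] lm tE srt_t]]]]].
by exists [:: i; j; k; l; m]; split=> //=; rewrite ?lij ?ljk ?lkl ?llm //; lia.
Qed.

Lemma avoids4P (n : nat) (pi : 'S_n) (a b c d : nat) (q : seq nat) :
  perm_eq q (iota 0 4) -> sorted ltn [seq nth 0 [:: a; b; c; d] i | i <- q] ->
  let f := nth 0 (word pi) in
  avoids pi [:: a; b; c; d] <->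
  forall i j k l, i < j -> j < k -> k < l -> l < size (word pi) ->
    ~~ sorted ltn [seq nth 0 [:: f i; f j; f k; f l] x | x <- q].
Proof.
move=> pq srt f; split=> [av i j k l lij ljk lkl ll|av [t]].
  apply/negP => srt_t; apply: av; exists [:: f i; f j; f k; f l].
  by apply/(is_copy4P _ _ pq srt); exists i, j, k, l.
case/(is_copy4P _ _ pq srt) => i [j [k [l [[lij ljk lkl] ll tE srt_t]]]].
by move: srt_t; apply/negP; rewrite tE; apply: av.
Qed.

(** The barred entry is the smallest, so comparing it with the next smallest, the last entry of the
    copy, is enough. *)
Lemma avoids_barred1P (n : nat) (pi : 'S_n) :
  let f := nth 0 (word pi) in
  avoids_barred pi [:: 4; 1; 3; 5; 2] [:: 1] <->
  forall i j k l, i < j -> j < k -> k < l -> l < size (word pi) ->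
    f l < f j /\ f j < f i < f k -> exists2 m, i < m < j & f m < f l.
Proof.
move=> f; have inj a b : a < size (word pi) -> b < size (word pi) ->
    f a = f b -> a = b.
  by move=> lta ltb /eqP; rewrite nth_uniq ?word_uniq // => /eqP.
(* Only relative order matters, so 4352 stands for 3241 without renumbering. *)
have copy4 t := @is_copy4P n pi 4 3 5 2 [:: 3; 1; 0; 2] t isT isT.
have copy5 t := @is_copy5P n pi 4 1 3 5 2 [:: 1; 4; 2; 0; 3] t isT isT.
split=> [av i j k l lij ljk lkl ll [lt1 /andP[lt2 lt3]]|av t].
  have [|u /copy5[i' [m [j' [k' [l' [lts ltl' ->]]]]]]] :=
    av [:: f i; f j; f k; f l].
    by apply/copy4; exists i, j, k, l; split=> //=; rewrite lt1 lt2 lt3.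
  (* The extension agrees with the given copy in values only; injectivity of [f] identifies the
     positions that bound [m]. *)
  case: lts => lt_im lt_mj lt_jk lt_kl /= /andP[lt_ml _] [/inj Ei /inj Ej _ <-].
  have ltk' := ltn_trans lt_kl ltl'; have ltj' := ltn_trans lt_jk ltk'.
  have lti' := ltn_trans lt_im (ltn_trans lt_mj ltj').
  have ltj := ltn_trans ljk (ltn_trans lkl ll); have lti := ltn_trans lij ltj.
  by exists m => //; rewrite -Ei // -Ej // lt_im.
case/copy4 => i [j [k [l [[lij ljk lkl] ll -> /= /and4P[lt1 lt2 lt3 _]]]]].
have [|m /andP[lim lmj] lt_ml] := av i j k l lij ljk lkl ll;
  first by rewrite lt1 lt2.
exists [:: f i; f m; f j; f k; f l] => //.
by apply/copy5; exists i, m, j, k, l; split=> //=; rewrite ?lt_ml ?lt1 ?lt2 ?lt3.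
Qed.

(** The barred entry is the largest, so it need only exceed the first entry of the copy, the next
    largest. *)
Lemma avoids_barred5P (n : nat) (pi : 'S_n) :
  let f := nth 0 (word pi) in
  avoids_barred pi [:: 4; 1; 3; 5; 2] [:: 5] <->
  forall i j k l, i < j -> j < k -> k < l -> l < size (word pi) ->
    f j < f l /\ f l < f k < f i -> exists2 m, k < m < l & f i < f m.
Proof.
move=> f; have inj a b : a < size (word pi) -> b < size (word pi) ->
    f a = f b -> a = b.
  by move=> lta ltb /eqP; rewrite nth_uniq ?word_uniq // => /eqP.
have copy4 t := @is_copy4P n pi 4 1 3 2 [:: 1; 3; 2; 0] t isT isT.
have copy5 t := @is_copy5P n pi 4 1 3 5 2 [:: 1; 4; 2; 0; 3] t isT isT.
split=> [av i j k l lij ljk lkl ll [lt1 /andP[lt2 lt3]]|av t].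
  have [|u /copy5[i' [j' [k' [m [l' [lts ltl' ->]]]]]]] :=
    av [:: f i; f j; f k; f l].
    by apply/copy4; exists i, j, k, l; split=> //=; rewrite lt1 lt2 lt3.
  case: lts => lt_ij lt_jk lt_km lt_ml /=.
  case/and5P => _ _ _ lt_im _ [<- _ /inj Ek /inj El].
  have ltk' := ltn_trans lt_km (ltn_trans lt_ml ltl').
  have ltk := ltn_trans lkl ll.
  by exists m => //; rewrite -Ek // -El // lt_km.
case/copy4 => i [j [k [l [[lij ljk lkl] ll -> /= /and4P[lt1 lt2 lt3 _]]]]].
have [|m /andP[lim lmj] lt_ml] := av i j k l lij ljk lkl ll;
  first by rewrite lt1 lt2.
exists [:: f i; f j; f k; f m; f l] => //.
by apply/copy5; exists i, j, k, m, l; split=> //=; rewrite ?lt_ml ?lt1 ?lt2 ?lt3.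
Qed.

Theorem theorem1 (n : nat) (pi : 'S_n) :
  two_pop_stack_sortable pi <->
  (avoids pi [:: 2; 3; 4; 1] /\
   avoids pi [:: 3; 4; 1; 2] /\
   avoids pi [:: 3; 4; 2; 1] /\
   avoids pi [:: 4; 1; 2; 3] /\
   avoids pi [:: 4; 2; 3; 1] /\
   avoids pi [:: 4; 3; 1; 2] /\
   avoids_barred pi [:: 4; 1; 3; 5; 2] [:: 1] /\
   avoids_barred pi [:: 4; 1; 3; 5; 2] [:: 5]).
Proof.
rewrite two_pop_stack_sortableE sorted_pop_stack2 ?word_uniq //.
rewrite run_conditions_patterns ?word_uniq // avoids_barred1P avoids_barred5P.
(* Each list gives the 0-based positions of the values 1, 2, 3, 4 in the pattern. *)
rewrite (@avoids4P n pi 2 3 4 1 [:: 3; 0; 1; 2]) //.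
rewrite (@avoids4P n pi 3 4 1 2 [:: 2; 3; 0; 1]) //.
rewrite (@avoids4P n pi 3 4 2 1 [:: 3; 2; 0; 1]) //.
rewrite (@avoids4P n pi 4 1 2 3 [:: 1; 2; 3; 0]) //.
rewrite (@avoids4P n pi 4 2 3 1 [:: 3; 1; 2; 0]) //.
rewrite (@avoids4P n pi 4 3 1 2 [:: 2; 3; 1; 0]) //=.
set f := nth 0 (word pi); split.
  move=> H; split; last split; last split; last split; last split; last split;
    last split; move=> i j k l lij ljk lkl ll;
    have [[N1 N2 N3 N4 N5] [N6 B1 B5]] := H i j k l lij ljk lkl ll => //;
    apply/and4P => -[lt1 lt2 lt3 _].
  - by apply: N1; rewrite lt1 lt2.
  - by apply: N2; rewrite lt1 lt2.
  - by apply: N3; rewrite lt1 lt2.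
  - by apply: N4; rewrite lt1 lt2.
  - by apply: N5; rewrite lt1 lt2.
  - by apply: N6; rewrite lt1 lt2.
case=> N1 [N2 [N3 [N4 [N5 [N6 [B1 B5]]]]]] i j k l lij ljk lkl ll.
have chain a b c d : ~~ [&& a < b, b < c, c < d & true] -> ~ (a < b /\ b < c < d).
  by move=> /negP nc [lt1 lt2]; apply: nc; rewrite lt1 andbT.
split; split; try by apply: chain; auto.
  exact: B1.
exact: B5.
Qed.
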